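(* Let $m\ge 1$, let $M\in S_m^+$, and let $(e_0,\dots,e_m)$ be an $M$-obtuse superbase of $\mathbb{Z}^m$ (assuming one exists). For each of the $(m+1)!$ permutations $(b_i)_{i=0}^m$ of $(e_i)_{i=0}^m$, consider the simplex with vertices $\left(\sum_{i=0}^{k-1} b_i\right)_{k=0}^{m}$ (the empty sum, for $k=0$, being $0$). Then the collection $\mathcal{T}(M)$ of all these simplices is an $M$-acute mesh, and it has $2^{m+1}-1$ vertices.
   Context: $S_m^+$ is the set of $m\times m$ symmetric positive definite real matrices; $\langle\cdot,\cdot\rangle$ is the Euclidean scalar product on $\mathbb{R}^m$. A basis of $\mathbb{Z}^m$ is an $m$-tuple $(e_1,\dots,e_m)\in(\mathbb{Z}^m)^m$ such that $|\det(e_1,\dots,e_m)|=1$. A superbase of $\mathbb{Z}^m$ is an $(m+1)$-tuple $(e_0,\dots,e_m)$ such that $e_0+\dots+e_m=0$ and $(e_1,\dots,e_m)$ is a basis of $\mathbb{Z}^m$. A superbase $(e_0,\dots,e_m)$ is $M$-obtuse iff $\langle e_i,Me_j\rangle\le 0$ for all $0\le i<j\le m$. A mesh in $\mathbb{R}^m$ is a finite collection $\mathcal{T}$ of $m$-dimensional non-flat simplices which is conforming: the intersection $T\cap T'$ of any $T,T'\in\mathcal{T}$ is the convex hull of their common vertices. The vertices of a mesh are the (distinct) points which are vertices of at least one of its simplices. For $M\in S_m^+$, an $M$-acute mesh is a mesh $\mathcal{T}$ in $\mathbb{R}^m$ covering a neighborhood of the origin and such that the vertices $v_0,\dots,v_m$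 of any simplex $T\in\mathcal{T}$ (suitably ordered) satisfy (i) $v_0=0$, (ii) $(v_1,\dots,v_m)$ is a basis of $\mathbb{Z}^m$, and (iii) $\langle v_i,Mv_j\rangle\ge 0$ for all $1\le i<j\le m$. *)

(* Defs.v *)
From HB Require Import structures.
From mathcomp Require Import all_boot all_order all_algebra all_fingroup.
From mathcomp Require Import all_classical all_reals all_analysis.

Set Implicit Arguments.
Unset Strict Implicit.
Unset Printing Implicit Defensive.

Import Order.TTheory GRing.Theory Num.Theory.
Import numFieldNormedType.Exports.

Local Open Scope classical_set_scope.
Local Open Scope ring_scope.

(** Indexing: a tuple [(x_0, ..., x_m)] is a function on ['I_m.+1]; its tail
    [(x_1, ..., x_m)] is [fun i : 'I_m => x (lift ord0 i)]. *)

Definition dot (R : realType) (m : nat) (x y : 'cV[R]_m) : R :=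
  \sum_(i < m) x i 0 * y i 0.

Definition sym_posdef (R : realType) (m : nat) (M : 'M[R]_m) : Prop :=
  M^T = M /\ forall x : 'cV[R]_m, x != 0 -> 0 < dot x (M *m x).

Definition Zembed (R : realType) (m : nat) (x : 'cV[int]_m) : 'cV[R]_m :=
  map_mx intr x.
Arguments Zembed R {m} x.

Definition is_Zbasis (m : nat) (e : 'I_m -> 'cV[int]_m) : Prop :=
  `|\det (\matrix_(i, j) e j i 0)| = 1.

Definition is_superbase (m : nat) (e : 'I_m.+1 -> 'cV[int]_m) : Prop :=
  \sum_(i < m.+1) e i = 0 /\ is_Zbasis (fun i : 'I_m => e (lift ord0 i)).

Definition obtuse (R : realType) (m : nat) (M : 'M[R]_m)
    (e : 'I_m.+1 -> 'cV[int]_m) : Prop :=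
  forall i j : 'I_m.+1, (i < j)%N ->
    dot (Zembed R (e i)) (M *m Zembed R (e j)) <= 0.

Definition conv_hull (R : realType) (m : nat) (A : set 'cV[R]_m) :
    set 'cV[R]_m :=
  [set x | exists (n : nat) (p : 'I_n -> 'cV[R]_m) (w : 'I_n -> R),
    [/\ forall i, A (p i), forall i, 0 <= w i, \sum_(i < n) w i = 1
      & x = \sum_(i < n) w i *: p i]].

Definition affinely_independent (R : realType) (m : nat)
    (v : 'I_m.+1 -> 'cV[R]_m) : Prop :=
  row_free (\matrix_(i < m) (v (lift ord0 i) - v ord0)^T).

(** [T] is the non-flat [m]-simplex of R^m with vertices [v_0, ..., v_m]. *)
Definition is_simplex_of (R : realType) (m : nat)
    (v : 'I_m.+1 -> 'cV[R]_m) (T : set 'cV[R]_m) : Prop :=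
  affinely_independent v /\ T = conv_hull (range v).

(** The vertices of a non-flat simplex are determined, up to order, by the
    underlying set of points, so at most one [range v] occurs here. *)
Definition simplex_vertices (R : realType) (m : nat) (T : set 'cV[R]_m) :
    set 'cV[R]_m :=
  [set x | exists2 v : 'I_m.+1 -> 'cV[R]_m, is_simplex_of v T & range v x].

Definition is_mesh (R : realType) (m : nat) (Ts : set (set 'cV[R]_m)) : Prop :=
  [/\ finite_set Ts,
      forall T, Ts T -> exists v : 'I_m.+1 -> 'cV[R]_m, is_simplex_of v T
    & forall T T', Ts T -> Ts T' ->
        T `&` T' = conv_hull (simplex_vertices T `&` simplex_vertices T')].

Definition mesh_vertices (R : realType) (m : nat) (Ts : set (set 'cV[R]_m)) :
    set 'cV[R]_m :=
  \bigcup_(T in Ts) simplex_vertices T.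

Definition is_acute_mesh (R : realType) (m : nat) (M : 'M[R]_m)
    (Ts : set (set 'cV[R]_m)) : Prop :=
  [/\ is_mesh Ts,
      nbhs (0 : 'cV[R]_m) (\bigcup_(T in Ts) T)
    & forall T, Ts T ->
        exists v : 'I_m.+1 -> 'cV[R]_m,
        [/\ is_simplex_of v T,
            v ord0 = 0,
            exists2 u : 'I_m -> 'cV[int]_m,
              is_Zbasis u & forall i, v (lift ord0 i) = Zembed R (u i)
          & forall i j : 'I_m.+1, (0 < i)%N -> (i < j)%N ->
              0 <= dot (v i) (M *m v j)]].

Definition partial_sums (R : realType) (m : nat) (b : 'I_m.+1 -> 'cV[int]_m)
    (k : 'I_m.+1) : 'cV[R]_m :=
  \sum_(i < m.+1 | (i < k)%N) Zembed R (b i).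
Arguments partial_sums R {m} b k.

Definition superbase_mesh (R : realType) (m : nat)
    (e : 'I_m.+1 -> 'cV[int]_m) : set (set 'cV[R]_m) :=
  [set conv_hull (range (partial_sums R (fun i => e (s i))))
    | s in [set: 'S_m.+1]].
Arguments superbase_mesh R {m} e.

(* Main.v *)
Require Import Defs.
From HB Require Import structures.
From mathcomp Require Import all_boot all_order all_algebra all_fingroup.
From mathcomp Require Import all_classical all_reals all_analysis.
From mathcomp Require Import lra.

(** Write E_i for the vectors of the superbase, seen in R^m.  Since they sum to
    zero and any m of them form a basis, each point x of R^m is a combination
    sum_i a_i E_i whose coefficients are unique up to adding one constant to
    all of them ([superbase_coord_const]).  This redundant coordinate system is
    symmetric in the m+1 vectors, and in it the whole mesh becomes a statement
    about sorting.

    By summation by parts, the simplex of a permutation s is the set of points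
    whose coefficients are nonincreasing along s and spread over an interval of
    length at most 1 ([mem_superbase_simplex]); for k > 0 the barycentric weight
    of the k-th vertex is the gap between the consecutive values a_(s (k-1)) and
    a_(s k).  Neither the order relations nor the spread see the additive
    constant, so the description does not depend on the choice of a.

    Covering.  Points near 0 have coefficients of spread at most 1
    ([superbase_coord_small]), and any family of reals is sorted along some
    permutation.

    Conformity.  Let x lie in the simplices of s and t.  Its coefficients are
    nonincreasing along both.  A vertex k > 0 of the first simplex with positive
    weight sits at a strict gap, so it is the sum of the E_j over a set of the
    form {j | r < a_j}.  Such a set depends on a alone, and it is an initial
    segment of every permutation that sorts a, in particular of t: the vertex
    also belongs to the second simplex ([weight_vertex_shared]).  Hence x is a
    convex combination of common vertices.

    Acuteness.  Partial sums of the integer vectors form a basis because their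
    consecutive differences give back all the e_i ([prefix_Zbasis]).  For i < j
    the j-th partial sum is minus the sum of the remaining vectors, so the
    scalar product of two partial sums is minus a sum of products of distinct
    vectors of the superbase, each of which is nonpositive.

    Counting.  The vertices are the sums of the E_j over the proper subsets of
    the m+1 indices, every such subset being an initial segment of some
    permutation.  Distinct proper subsets have distinct sums: two indicator
    functions that differ by a constant and both take the value 0 are equal. *)

Set Implicit Arguments.
Unset Strict Implicit.
Unset Printing Implicit Defensive.

Import Order.TTheory GRing.Theory Num.Theory.
Import numFieldNormedType.Exports.

Local Open Scope classical_set_scope.
Local Open Scope ring_scope.
Local Open Scope card_scope.

(** * Convex hulls and the vertices of a simplex *)

Section Simplices.
Variables (R : realType) (m : nat).
Implicit Types (A B T : set 'cV[R]_m).

Lemma conv_hullS A B : A `<=` B -> conv_hull A `<=` conv_hull B.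
Proof.
move=> AB x [n [p [w [pA w0 w1 ->]]]]; exists n, p, w; split=> // i.
exact/AB/pA.
Qed.

Lemma conv_hull_range n (v : 'I_n -> 'cV[R]_m) x :
  conv_hull (range v) x <->
  exists c : 'I_n -> R,
    [/\ forall i, 0 <= c i, \sum_i c i = 1 & x = \sum_i c i *: v i].
Proof.
split=> [[k [p [w [pv w0 w1 ->]]]]|[c [c0 c1 ->]]]; last first.
  by exists n, v, c; split=> // i; exists i.
have /fin_all_exists[f fp] i : exists j, v j = p i.
  by have [j _ <-] := pv i; exists j.
exists (fun j => \sum_(i | f i == j) w i); split.
- by move=> j; apply: sumr_ge0 => i _.
- rewrite -w1 [RHS](partition_big f xpredT) //=.
- rewrite (partition_big f xpredT) //=; apply: eq_bigr => j _.
  rewrite scaler_suml; apply: eq_bigr => i /eqP <-.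
  by rewrite fp.
Qed.

Lemma conv_hull_extreme n (v : 'I_n -> 'cV[R]_m) i : conv_hull (range v) (v i).
Proof.
apply/conv_hull_range; exists (fun j => (j == i)%:R); split=> [j||].
- exact: ler0n.
- by rewrite (bigD1 i) //= eqxx big1 ?addr0 // => j /negPf->.
- rewrite (bigD1 i) //= eqxx scale1r big1 ?addr0 // => j /negPf->.
  by rewrite scale0r.
Qed.

Lemma affine_coord_inj (v : 'I_m.+1 -> 'cV[R]_m) (c d : 'I_m.+1 -> R) :
  affinely_independent v -> \sum_i c i = \sum_i d i ->
  \sum_i c i *: v i = \sum_i d i *: v i -> c =1 d.
Proof.
move=> vfree cd cdv.
pose g i := c i - d i.
have g_sum : \sum_i g i = 0 by rewrite big_split /= sumrN cd subrr.
have gv_sum : \sum_i g i *: (v i - v ord0) = 0.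
  under eq_bigr => i _ do rewrite scalerBr scalerBl.
  by rewrite !sumrB cdv subrr -scaler_suml g_sum scale0r subr0.
have g_lift i : g (lift ord0 i) = 0.
  have : (\row_i g (lift ord0 i)) *m
      (\matrix_(i < m) (v (lift ord0 i) - v ord0)^T) = 0.
    rewrite mulmx_sum_row.
    under eq_bigr => k _ do rewrite rowK mxE -linearZ /=.
    rewrite -linear_sum /=; move: gv_sum; rewrite big_ord_recl subrr scaler0.
    by rewrite add0r => ->; rewrite trmx0.
  rewrite -(mul0mx 1 (\matrix_(i < m) (v (lift ord0 i) - v ord0)^T)).
  by move/(row_free_inj vfree)/rowP/(_ i); rewrite !mxE.
move=> i; apply/eqP; rewrite -subr_eq0 -/(g i); apply/eqP.
have [j ->|->] := unliftP ord0 i; first by rewrite g_lift.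
move: g_sum; rewrite big_ord_recl big1 ?addr0 // => j _; exact: g_lift.
Qed.

(** The vertices of a simplex are extreme points of it.  Write v_i as a convex
    combination of the w_j, and each w_j as one of the v_k.  Uniqueness of the
    barycentric coordinates of v_i forces every w_j of positive weight to have
    no component on v_k for k <> i, so that w_j = v_i. *)
Lemma affine_range_sub n (v : 'I_m.+1 -> 'cV[R]_m) (w : 'I_n -> 'cV[R]_m) :
  affinely_independent v -> conv_hull (range v) = conv_hull (range w) ->
  range v `<=` range w.
Proof.
move=> vfree vw _ [i _ <-].
have [c [c0 c1 vic]] : exists c : 'I_n -> R,
    [/\ forall j, 0 <= c j, \sum_j c j = 1 & v i = \sum_j c j *: w j].
  by apply/conv_hull_range; rewrite -vw; exact: conv_hull_extreme.
have /fin_all_exists[d dP] j : exists d : 'I_m.+1 -> R,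
    [/\ forall k, 0 <= d k, \sum_k d k = 1 & w j = \sum_k d k *: v k].
  by apply/conv_hull_range; rewrite vw; exact: conv_hull_extreme.
have cd k : k != i -> \sum_j c j * d j k = 0.
  move=> ki.
  have /(_ k) : (fun k => \sum_j c j * d j k) =1 (fun k => (k == i)%:R).
    apply: (affine_coord_inj vfree).
      rewrite exchange_big /= -[RHS]/(\sum_k (k == i)%:R).
      rewrite [RHS](bigD1 i) //= eqxx [X in _ = _ + X]big1 ?addr0; last first.
        by move=> l /negPf->.
      rewrite -c1; apply: eq_bigr => j _; rewrite -mulr_sumr.
      by have [_ -> _] := dP j; rewrite mulr1.
    rewrite [RHS](bigD1 i) //= eqxx scale1r [X in _ = _ + X]big1 ?addr0.
      rewrite vic; under eq_bigr => l _ do rewrite scaler_suml.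
      rewrite exchange_big /=; apply: eq_bigr => j _.
      have [_ _ wj] := dP j; rewrite [in RHS]wj scaler_sumr.
      by apply: eq_bigr => l _; rewrite scalerA.
    by move=> l /negPf->; rewrite scale0r.
  by rewrite /= (negPf ki).
have [j cj] : exists j, 0 < c j.
  apply: contrapT => /forallNP cN.
  have : \sum_j c j = 0.
    by apply: big1 => j _; apply/le_anti; rewrite c0 andbT leNgt; exact/negP.
  by rewrite c1 => /eqP; rewrite oner_eq0.
have [dj0 dj1 wj] := dP j.
have dj k : k != i -> d j k = 0.
  move=> /cd /eqP; rewrite psumr_eq0 => [/allP/(_ j)|l _]; last first.
    by rewrite mulr_ge0 //; have [] := dP l.
  by rewrite mem_index_enum mulf_eq0 gt_eqF //= => /(_ isT)/eqP.
exists j => //; rewrite wj (bigD1 i) //= big1 ?addr0 => [|k /dj->]; last first.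
  by rewrite scale0r.
move: dj1; rewrite (bigD1 i) //= big1 ?addr0 => [->|k /dj//].
by rewrite scale1r.
Qed.

(** Any parametrization of a simplex may be used to compute its vertices: two
    of them have the same range, by applying the previous lemma both ways. *)
Lemma simplex_verticesE (v : 'I_m.+1 -> 'cV[R]_m) T :
  is_simplex_of v T -> simplex_vertices T = range v.
Proof.
move=> vT; apply/seteqP; split=> [x [w [wfree Tw] wx]|x vx]; last by exists v.
have [vfree Tv] := vT.
by apply: (affine_range_sub wfree) wx; rewrite -Tv -Tw.
Qed.

End Simplices.

(** * Families of reals sorted along a permutation *)

Definition sorted_along (R : realType) n (a : 'I_n -> R) (s : 'S_n) :=
  forall i j : 'I_n, (i <= j)%N -> a (s j) <= a (s i).

Lemma exists_sorted_along (R : realType) n (a : 'I_n.+1 -> R) :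
  exists s, sorted_along a s.
Proof.
pose r i j := a j <= a i.
pose l := sort r (enum 'I_n.+1).
have r_trans : transitive r.
  by move=> y x z; rewrite /r => yx zy; apply: le_trans yx.
have r_total : total r by move=> x y; exact: le_total.
have size_l : size l = n.+1 by rewrite size_sort size_enum_ord.
have l_inj : injective (fun i : 'I_n.+1 => nth ord0 l i).
  move=> i j /eqP; rewrite nth_uniq ?size_l ?sort_uniq ?enum_uniq //.
  by move/eqP/val_inj.
exists (perm l_inj) => i j ij; rewrite !permE.
apply: (sorted_leq_nth r_trans _ _ (sort_sorted r_total _));
  rewrite ?inE ?size_l // => x; exact: lexx.
Qed.

Section Sorting.
Variables (R : realType) (n : nat).
Implicit Types (a : 'I_n -> R) (s : 'S_n).

Definition superlevel a (t : R) : {set 'I_n} := [set j | t < a j]%SET.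

Lemma card_ord_ltn k : (k <= n)%N -> #|[set i : 'I_n | (i < k)%N]%SET| = k.
Proof.
move=> kn.
have widen_inj : injective (widen_ord kn).
  by move=> i j /(congr1 val) /= /val_inj.
rewrite -[RHS]card_ord -(card_imset predT widen_inj).
apply: eq_card => i; rewrite inE; apply/idP/imsetP => [ik|[j _ ->]];
  last exact: (ltn_ord j).
by exists (Ordinal ik) => //; apply: val_inj.
Qed.

(** A sorting permutation lists a superlevel set first.  The position of its end
    is the cardinal of the superlevel set, so it does not depend on which
    sorting permutation is taken: this is what makes neighbouring simplices
    agree along their common faces. *)
Lemma superlevel_prefix a s t i : sorted_along a s ->
  (t < a (s i)) = (i < #|superlevel a t|)%N.
Proof.
move=> a_s; have -> : #|superlevel a t| = #|superlevel (a \o s) t|.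
  rewrite -[RHS](card_imset _ (@perm_inj _ s)); apply: eq_card => j.
  rewrite inE; apply/idP/imsetP => [tj|[k + ->]]; last by rewrite inE.
  by exists (s^-1%g j); rewrite ?inE /= permKV.
apply/idP/idP => [ti|]; last first.
  apply: contraTT; rewrite -leNgt -leqNgt => it.
  rewrite -[leqRHS](card_ord_ltn (ltnW (ltn_ord i))); apply/subset_leq_card.
  apply/fintype.subsetP => j; rewrite !inE ltnNge; apply: contraTN => /a_s.
  by rewrite -leNgt => /le_trans; exact.
rewrite -(card_ord_ltn (ltn_ord i)); apply/subset_leq_card.
by apply/fintype.subsetP => j; rewrite !inE ltnS => /a_s; exact: lt_le_trans.
Qed.

End Sorting.

(** * Integral bases and coordinates in a superbase *)

Lemma mul_cols (K : comNzRingType) n p (u : 'I_p -> 'cV[K]_n) (c : 'cV[K]_p) :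
  (\matrix_(i, j) u j i 0) *m c = \sum_j c j 0 *: u j.
Proof.
apply/matrixP => i j; rewrite ord1 mxE summxE; apply: eq_bigr => k _.
by rewrite !mxE mulrC.
Qed.

Lemma Zbasis_unitmx (R : realType) m (u : 'I_m -> 'cV[int]_m) :
  is_Zbasis u -> \matrix_(i, j) Zembed R (u j) i 0 \in unitmx.
Proof.
rewrite /is_Zbasis; set B := \matrix_(i, j) _ => detB.
have -> : \matrix_(i, j) Zembed R (u j) i 0 = map_mx intr B.
  by apply/matrixP => i j; rewrite !mxE.
rewrite unitmxE det_map_mx unitfE intr_eq0 -normr_eq0.
by rewrite detB oner_eq0.
Qed.

(** The determinant of u is an integer multiple of that of v, hence the latter
    divides 1. *)
Lemma Zbasis_span m (u v : 'I_m -> 'cV[int]_m) :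
  is_Zbasis u -> (forall j, exists c : 'cV[int]_m, u j = \sum_k c k 0 *: v k) ->
  is_Zbasis v.
Proof.
rewrite /is_Zbasis => detu /fin_all_exists[c uc].
have uE : \matrix_(i, j) u j i 0 =
    (\matrix_(i, j) v j i 0) *m (\matrix_(i, j) c j i 0).
  apply/matrixP => i j; rewrite !mxE uc summxE; apply: eq_bigr => k _.
  by rewrite !mxE mulrC.
move: detu; rewrite uE det_mulmx normrM => /eqP; rewrite -!abszE -PoszM.
by rewrite eqz_nat muln_eq1 => /andP[/eqP-> _].
Qed.

Section Superbase.
Variables (R : realType) (m : nat) (e : 'I_m.+1 -> 'cV[int]_m).
Hypothesis sb : is_superbase e.
Local Notation E i := (Zembed R (e i)).

Lemma sum_superbase : \sum_i E i = 0.
Proof.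
by rewrite /Zembed -raddf_sum sb.1 raddf0.
Qed.

(** Subtracting the coefficient of E_0 from all the others does not change the
    combination, because the E_i sum to zero; what is left is a combination of
    the basis vectors E_1, ..., E_m, whose coefficients are unique. *)
Lemma superbase_coord_const (a b : 'I_m.+1 -> R) :
  \sum_i a i *: E i = \sum_i b i *: E i -> exists r, forall i, a i = b i + r.
Proof.
move=> ab; pose g i := a i - b i.
exists (g ord0) => i.
suff -> : g ord0 = g i by rewrite /g addrC subrK.
have gE : \sum_i (g i - g ord0) *: E i = 0.
  under eq_bigr => j _ do rewrite scalerBl [g j *: _]scalerBl.
  by rewrite !sumrB ab subrr -scaler_sumr sum_superbase scaler0 subrr.
have [j ->|-> //] := unliftP ord0 i.
have : (\matrix_(i, j) E (lift ord0 j) i 0) *m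
    (\col_j (g (lift ord0 j) - g ord0)) = 0.
  rewrite (mul_cols (fun j => E (lift ord0 j))).
  move: gE; rewrite big_ord_recl subrr scale0r add0r => gE.
  by rewrite -[RHS]gE; apply: eq_bigr => k _; rewrite mxE.
move/(congr1 (mulmx (invmx (\matrix_(i, j) E (lift ord0 j) i 0)))).
rewrite mulmx0 mulKmx; last exact: (Zbasis_unitmx R sb.2).
by move/colP/(_ j); rewrite !mxE => /eqP; rewrite subr_eq0 => /eqP.
Qed.

(** The coefficients with a_0 = 0 depend linearly on the point, so near the
    origin all of them are at most 1/2 in absolute value. *)
Lemma superbase_coord_small : \forall x \near (0 : 'cV[R]_m),
  exists2 a : 'I_m.+1 -> R, x = \sum_i a i *: E i & forall i j, a i - a j <= 1.
Proof.
pose B := \matrix_(i, j) E (lift ord0 j) i 0.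
have Bunit : B \in unitmx by exact: (Zbasis_unitmx R sb.2).
(* The added 1 keeps K positive, so that it can be inverted. *)
pose K : R := 1 + \sum_i \sum_j `|invmx B i j|.
have K0 : 0 < K.
  by rewrite ltr_pwDl // sumr_ge0 // => i _; rewrite sumr_ge0.
apply/nbhs_ballP; exists ((2 * K)^-1); first by rewrite /= invr_gt0 mulr_gt0.
move=> x [_ /= x_small].
pose c := invmx B *m x.
have c_small i : `|c i 0| <= 2^-1.
  rewrite mxE; apply: le_trans (ler_norm_sum _ _ _) _.
  have -> : 2^-1 = K * (2 * K)^-1 :> R.
    by rewrite invfM mulrCA mulfV ?mulr1 ?gt_eqF.
  apply: (@le_trans _ _ ((\sum_j `|invmx B i j|) * (2 * K)^-1)).
    rewrite mulr_suml; apply: ler_sum => j _; rewrite normrM ler_wpM2l //.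
    by apply/ltW; move: (x_small j 0); rewrite /ball /= mxE sub0r normrN.
  rewrite ler_wpM2r ?invr_ge0 ?mulr_ge0 ?(ltW K0) //.
  rewrite /K [X in _ <= _ + X](bigD1 i) //= addrCA lerDl.
  rewrite addr_ge0 // sumr_ge0 // => k _.
  by rewrite sumr_ge0.
exists (fun i => if unlift ord0 i is Some j then c j 0 else 0).
  rewrite big_ord_recl unlift_none scale0r add0r.
  under eq_bigr => j _ do rewrite liftK.
  by rewrite -(mul_cols (fun j => E (lift ord0 j))) -/B /c mulKVmx.
have half (i : 'I_m.+1) :
    `|if unlift ord0 i is Some j then c j 0 else 0| <= 2^-1 :> R.
  by case: (unlift _ _) => [j //|]; rewrite normr0 invr_ge0.
move=> i j; apply: le_trans (ler_norm _) _.
apply: le_trans (ler_normB _ _) _.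
apply: le_trans (lerD (half i) (half j)) _; lra.
Qed.

End Superbase.

(** * The simplices of a superbase *)

Section SuperbaseMesh.
Variables (R : realType) (m : nat) (e : 'I_m.+1 -> 'cV[int]_m).
Hypothesis sb : is_superbase e.
Implicit Types (a c : 'I_m.+1 -> R) (s t : 'S_m.+1).
Local Notation E i := (Zembed R (e i)).
Local Notation U s := (partial_sums R (fun i => e (s i))).

(** Summation by parts: the coefficient of E_j collects the weights of the
    partial sums in which E_j occurs. *)
Lemma partial_sums_comb c s :
  \sum_k c k *: U s k =
  \sum_j (\sum_(k < m.+1 | (s^-1%g j < k)%N) c k) *: E j.
Proof.
rewrite [RHS](reindex_inj (@perm_inj _ s)) /=.
under [RHS]eq_bigr => i _ do rewrite permK scaler_suml.
under eq_bigr => k _ do rewrite scaler_sumr.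
by rewrite (exchange_big_dep xpredT).
Qed.

(** The barycentric coordinates of the point sum_j a_j E_j in the simplex of s.
    The weight of the vertex 0 is what is missing from the telescoping sum of
    the gaps, which is a_(s 0) - a_(s m). *)
Definition simplex_weight a s (k : 'I_m.+1) : R :=
  if k == ord0 then 1 - (a (s ord0) - a (s ord_max))
  else a (s (inord k.-1)) - a (s k).

Lemma simplex_weight_tail a s (i : 'I_m.+1) :
  \sum_(k < m.+1 | (i < k)%N) simplex_weight a s k = a (s i) - a (s ord_max).
Proof.
pose h n := a (s (inord n)).
transitivity (\sum_(i.+1 <= k < m.+1) (h k.-1 - h k)).
  rewrite big_geq_mkord; apply: eq_bigr => k ik.
  rewrite /simplex_weight /h inord_val ifN //.
  by apply: contraTneq ik => ->.
rewrite big_add1 /= -[RHS]opprB -[in RHS](inord_val i) -[ord_max]inord_val.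
rewrite -/(h i) -/(h m) -(telescope_sumr h (ltn_ord i : i <= m)%N) -sumrN.
by apply: eq_bigr => k _; rewrite opprB.
Qed.

Lemma sum_simplex_weight a s : \sum_k simplex_weight a s k = 1.
Proof.
rewrite (bigD1 ord0) //=.
under eq_bigl => k do rewrite -lt0n.
by rewrite (simplex_weight_tail a s ord0) subrK.
Qed.

(** The weights give back the coefficients only up to the constant a_(s m),
    which is invisible because the E_j sum to zero. *)
Lemma superbase_comb_weight a s :
  \sum_j a j *: E j = \sum_k simplex_weight a s k *: U s k.
Proof.
rewrite partial_sums_comb.
under [RHS]eq_bigr => j _ do rewrite simplex_weight_tail permKV scalerBl.
by rewrite sumrB -scaler_sumr (sum_superbase R sb) scaler0 subr0.
Qed.

Lemma simplex_weight_ge0 a s k :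
  sorted_along a s -> a (s ord0) - a (s ord_max) <= 1 ->
  0 <= simplex_weight a s k.
Proof.
move=> a_s a1; rewrite /simplex_weight; case: eqP => [_|_].
  by rewrite subr_ge0.
rewrite subr_ge0; apply: a_s; rewrite inordK ?leq_pred //.
exact: leq_ltn_trans (leq_pred _) (ltn_ord k).
Qed.

Lemma mem_superbase_simplex s x :
  conv_hull (range (U s)) x <->
  exists a, [/\ sorted_along a s, a (s ord0) - a (s ord_max) <= 1
              & x = \sum_j a j *: E j].
Proof.
rewrite conv_hull_range; split=> [[c [c0 c1 ->]]|[a [a_s a1 ->]]]; last first.
  exists (simplex_weight a s); split=> [k||]; first exact: simplex_weight_ge0.
    exact: sum_simplex_weight.
  exact: superbase_comb_weight.
exists (fun j => \sum_(k < m.+1 | (s^-1%g j < k)%N) c k); split.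
- move=> i j ij; rewrite !permK.
  rewrite [leRHS](bigID (fun k : 'I_m.+1 => (j < k)%N)) /=.
  rewrite [X in X + _](eq_bigl (fun k : 'I_m.+1 => (j < k)%N)) => [|k].
    by rewrite lerDl sumr_ge0.
  by rewrite andb_idl //; exact: leq_ltn_trans.
- rewrite !permK [X in _ - X]big1 => [|k]; last first.
    by rewrite ltnNge -ltnS ltn_ord.
  rewrite subr0 -c1 [leRHS](bigD1 ord0) //=.
  rewrite [leLHS](eq_bigl (fun k => k != ord0)) ?lerDr // => k.
  by rewrite -lt0n.
- exact: partial_sums_comb.
Qed.

Lemma partial_sums_superlevel a s r (k : 'I_m.+1) :
  sorted_along a s -> #|superlevel a r| = k ->
  U s k = \sum_(j in superlevel a r) E j.
Proof.
move=> a_s rk; rewrite [RHS](reindex_inj (@perm_inj _ s)) /=.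
by apply: eq_bigl => i; rewrite inE (superlevel_prefix _ _ a_s) rk.
Qed.

Lemma partial_sums0 s : U s ord0 = 0.
Proof. by rewrite /partial_sums big_pred0. Qed.

(** A positive weight at k > 0 is a strict drop of a between positions k-1 and
    k, so that exactly k coefficients exceed the value at position k; both
    partial sums then run over that superlevel set. *)
Lemma weight_vertex_shared a s t k :
  sorted_along a s -> sorted_along a t -> 0 < simplex_weight a s k ->
  U s k = U t k.
Proof.
move=> a_s a_t; rewrite /simplex_weight; case: eqP => [->|/eqP k0].
  by rewrite !partial_sums0.
rewrite subr_gt0 => gap.
have kN : #|superlevel a (a (s k))| = k.
  apply/eqP; rewrite eqn_leq leqNgt -(superlevel_prefix _ _ a_s) ltxx /=.
  move: gap; rewrite (superlevel_prefix _ _ a_s) inordK.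
    by rewrite prednK // lt0n.
  exact: leq_ltn_trans (leq_pred _) (ltn_ord k).
by rewrite (partial_sums_superlevel a_s kN) (partial_sums_superlevel a_t kN).
Qed.

Lemma superbase_simplex_meet s t :
  conv_hull (range (U s)) `&` conv_hull (range (U t)) =
  conv_hull (range (U s) `&` range (U t)).
Proof.
apply/seteqP; split=> x; last first.
  by move=> xst; split; apply: conv_hullS xst => y [].
case=> /mem_superbase_simplex[a [a_s a1 xa]].
move=> /mem_superbase_simplex[b [b_t _ xb]].
have [r abr] := superbase_coord_const sb (etrans (esym xa) xb).
have a_t : sorted_along a t by move=> i j ij; rewrite !abr lerD2r b_t.
pose w := simplex_weight a s.
have w0 k : 0 <= w k by exact: simplex_weight_ge0.
(* Vertices of weight zero need not be shared, so they are replaced by the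
   vertex 0, which all the simplices have in common. *)
exists m.+1, (fun k => if w k == 0 then 0 else U s k), w; split=> //.
- move=> k; case: ifPn => [_|wk].
    by split; exists ord0 => //; exact: partial_sums0.
  split; exists k => //; apply/esym/(weight_vertex_shared a_s a_t).
  by rewrite lt_def wk w0.
- exact: sum_simplex_weight.
- rewrite xa (superbase_comb_weight a s); apply: eq_bigr => k _.
  by rewrite -/(w k); case: eqP => // ->; rewrite !scale0r.
Qed.

(** With P n the sum of the first n vectors, the permuted e_p is P (p+1) - P p.
    The extreme cases are harmless because P 0 and P (m+1) both vanish. *)
Lemma prefix_Zbasis s :
  is_Zbasis (fun k : 'I_m => \sum_(i < m.+1 | (i < k.+1)%N) e (s i)).
Proof.
apply: (Zbasis_span sb.2) => j.
pose P n := \sum_(i < m.+1 | (i < n)%N) e (s i).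
have spanP n : (n <= m.+1)%N ->
    exists c : 'cV[int]_m, P n = \sum_(k < m) c k 0 *: P k.+1.
  case: n => [_|k].
    exists 0; rewrite big1 => [|k _]; last by rewrite mxE scale0r.
    by rewrite /P big_pred0.
  rewrite ltnS leq_eqVlt => /predU1P[->|km].
    exists 0; rewrite big1 => [|k' _]; last by rewrite mxE scale0r.
    rewrite -[RHS]sb.1 [RHS](reindex_inj (@perm_inj _ s)).
    by apply: eq_bigl => i; rewrite ltn_ord.
  exists (delta_mx (Ordinal km) 0).
  rewrite (bigD1 (Ordinal km)) //= mxE !eqxx scale1r big1 ?addr0 // => i.
  by rewrite mxE => /negPf->; rewrite scale0r.
pose p := s^-1%g (lift ord0 j).
have [c cP] := spanP p.+1 (ltn_ord p).
have [d dP] := spanP p (ltnW (ltn_ord p)).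
exists (c - d).
transitivity (P p.+1 - P p); last first.
  rewrite cP dP -sumrB; apply: eq_bigr => k _.
  by rewrite !mxE scalerBl.
rewrite {1}/P (bigD1 p) //= permKV -/p.
rewrite (eq_bigl (fun i : 'I_m.+1 => (i < p)%N)) ?addrK // => i.
by rewrite ltnS [in RHS]ltn_neqAle andbC.
Qed.

Lemma partial_sums_lift s (k : 'I_m) :
  U s (lift ord0 k) = Zembed R (\sum_(i < m.+1 | (i < k.+1)%N) e (s i)).
Proof. by rewrite /Zembed raddf_sum. Qed.

Lemma superbase_simplex s : is_simplex_of (U s) (conv_hull (range (U s))).
Proof.
split=> //; rewrite /affinely_independent row_free_unit -unitmx_tr.
apply: etrans (Zbasis_unitmx R (prefix_Zbasis s)); congr (_ \in unitmx).
apply/matrixP => i j; rewrite mxE [RHS]mxE mxE mxE.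
by rewrite partial_sums0 subr0 partial_sums_lift.
Qed.

Lemma superbase_mesh_is_mesh : is_mesh (superbase_mesh R e).
Proof.
split.
- by apply: finite_image; exact: finite_finset.
- by move=> _ [s _ <-]; exists (U s); exact: superbase_simplex.
- move=> _ _ [s _ <-] [t _ <-].
  rewrite !(simplex_verticesE (superbase_simplex _)).
  exact: superbase_simplex_meet.
Qed.

Lemma superbase_mesh_nbhs :
  nbhs (0 : 'cV[R]_m) (\bigcup_(T in superbase_mesh R e) T).
Proof.
apply: filterS (superbase_coord_small R sb) => x [a xa a1].
have [s a_s] := exists_sorted_along a.
exists (conv_hull (range (U s))); first by exists s.
by apply/mem_superbase_simplex; exists a.
Qed.

Lemma partial_sumsN s j :
  U s j = - \sum_(l < m.+1 | (j <= l)%N) E (s l).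
Proof.
apply/eqP; rewrite -addr_eq0 -[X in _ == X](sum_superbase R sb).
rewrite [X in _ == X](reindex_inj (@perm_inj _ s)) /=.
rewrite [X in _ == X](bigID (fun i : 'I_m.+1 => (i < j)%N)) /=.
by under [X in _ == _ + X]eq_bigl => i do rewrite -leqNgt.
Qed.

(** Rewriting only the longer of the two sums as minus the sum of the remaining
    vectors makes the two index sets disjoint, so that obtuseness applies to
    every term of the expansion. *)
Lemma partial_sums_acute (M : 'M[R]_m) s (i j : 'I_m.+1) :
  M^T = M -> obtuse M e -> (i < j)%N -> 0 <= dot (U s i) (M *m U s j).
Proof.
move=> Msym Mobt ij.
have dotE (x y : 'cV[R]_m) : dot x y = (x^T *m y) 0 0.
  by rewrite mxE; apply: eq_bigr => k _; rewrite mxE.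
have obt p q : p != q -> dot (E p) (M *m E q) <= 0.
  rewrite neq_ltn => /orP[/Mobt //|/Mobt].
  rewrite !dotE mulmxA -[_ *m _ *m _]trmxK mxE.
  by rewrite !trmx_mul !trmxK Msym.
rewrite [partial_sums _ _ j]partial_sumsN /partial_sums dotE raddf_sum.
rewrite !mulmxN mxE oppr_ge0 mulmx_suml summxE; apply: sumr_le0 => k ki.
rewrite !mulmx_sumr summxE; apply: sumr_le0 => l jl.
rewrite -dotE; apply: obt; rewrite (inj_eq perm_inj).
by rewrite neq_ltn (leq_trans ki (leq_trans (ltnW ij) jl)).
Qed.

(** The sums over two proper subsets agree only if the indicators of the subsets
    differ by a constant r.  An index outside A gives r <= 0, and one outside B
    gives r >= 0. *)
Lemma subset_sum_inj (A B : {set 'I_m.+1}) :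
  A != [set: 'I_m.+1]%SET -> B != [set: 'I_m.+1]%SET ->
  \sum_(j in A) E j = \sum_(j in B) E j -> A = B.
Proof.
have indE (C : {set 'I_m.+1}) :
    \sum_(j in C) E j = \sum_j (j \in C)%:R *: E j :> 'cV[R]_m.
  rewrite big_mkcond; apply: eq_bigr => j _.
  by case: (j \in C); rewrite ?scale1r ?scale0r.
rewrite !indE -!finset.subTset => /subsetPn[p _ pA] /subsetPn[q _ qB].
case/(superbase_coord_const sb) => r ABr.
have r0 : r = 0.
  apply/le_anti/andP; split.
    by have := ABr p; rewrite (negPf pA); case: (_ \in B) => /=; lra.
  by have := ABr q; rewrite (negPf qB); case: (_ \in A) => /=; lra.
apply/setP => j; have := ABr j; rewrite r0 addr0 => /eqP.
by rewrite eqr_nat; case: (j \in A); case: (j \in B).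
Qed.

(** A proper subset A is an initial segment of any permutation that sorts its
    indicator function, so its sum is the vertex number #|A| of a simplex. *)
Lemma mesh_vertices_superbase :
  mesh_vertices (superbase_mesh R e) =
  (fun A : {set 'I_m.+1} => \sum_(j in A) E j) @`
    [set` [set~ [set: 'I_m.+1]]%SET].
Proof.
apply/seteqP; split=> [x [_ [s _ <-]]|_ [A /= + <-]].
  rewrite (simplex_verticesE (superbase_simplex s)) => -[k _ <-].
  exists [set s i | i : 'I_m.+1 & (i < k)%N]%SET => /=.
    rewrite !inE; apply/negP => /eqP/setP/(_ (s ord_max)).
    by rewrite (mem_imset _ _ perm_inj) !inE ltnNge -ltnS ltn_ord.
  rewrite big_imset /=; last by move=> ? ? _ _ /perm_inj.
  by apply: eq_bigl => i; rewrite inE.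
rewrite !inE => AT.
pose a j : R := (j \in A)%:R.
have aA : superlevel a 0 = A.
  by apply/setP => j; rewrite inE ltr0n lt0b.
have [s a_s] := exists_sorted_along a.
have Am : (#|A| < m.+1)%N.
  by rewrite -[X in (_ < X)%N]card_ord -cardsT proper_card // properT.
exists (conv_hull (range (U s))); first by exists s.
rewrite (simplex_verticesE (superbase_simplex s)).
exists (Ordinal Am) => //.
by rewrite (@partial_sums_superlevel a s 0) // aA.
Qed.

End SuperbaseMesh.

(** * Counting the vertices *)

Lemma card_eq_finset (T : finType) (A : {set T}) : [set` A] #= `I_#|A|.
Proof.
have -> : [set` A] = enum_val @` [set: 'I_#|A|].
  apply/seteqP; split=> [x xA|_ [i _ <-]] /=; last exact: enum_valP.
  by exists (enum_rank_in xA x) => //; rewrite enum_rankK_in.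
apply: card_eq_trans (inj_card_eq _) _; first by move=> ? ? _ _ /enum_val_inj.
by rewrite card_eq_sym card_II.
Qed.

Theorem proposition1p6 (R : realType) (m : nat) (M : 'M[R]_m)
    (e : 'I_m.+1 -> 'cV[int]_m) :
  (1 <= m)%N -> sym_posdef M -> is_superbase e -> obtuse M e ->
  is_acute_mesh M (superbase_mesh R e) /\
  mesh_vertices (superbase_mesh R e) #= `I_(2 ^ m.+1 - 1)%N.
Proof.
move=> _ [Msym _] sb Mobt; split.
  split; [exact: superbase_mesh_is_mesh|exact: superbase_mesh_nbhs|].
  move=> _ [s _ <-]; exists (partial_sums R (fun i => e (s i))); split.
  - exact: superbase_simplex.
  - exact: partial_sums0.
  - exists (fun k : 'I_m => \sum_(i < m.+1 | (i < k.+1)%N) e (s i)).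
      exact: prefix_Zbasis.
    exact: partial_sums_lift.
  - by move=> i j _ ij; exact: partial_sums_acute.
rewrite mesh_vertices_superbase //.
apply: card_eq_trans (inj_card_eq _) _.
  by move=> A B /set_mem /= + /set_mem /=; rewrite !inE; exact: subset_sum_inj.
have <- : #|[set~ [set: 'I_m.+1]]%SET| = (2 ^ m.+1 - 1)%N.
  by rewrite cardsC1 -cardsT -powersetT card_powerset cardsT card_ord subn1.
exact: card_eq_finset.
Qed.
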